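(* Let $0\ne T\ne I_X$ in $\mathcal{B}(X)$ have non-zero left and right annihilators, and let $T=\begin{bmatrix}T_1&T_2\\ 0&0\end{bmatrix}$ in $X=\mathcal{K}\oplus\mathcal{L}$ be a local block representation of $T$ with $T_1\ne I_{\mathcal{K}}$. Suppose $T_1C^{-1}=T_2D^{-1}$ for some invertible operators $C\in\mathcal{B}(\mathcal{K},\mathcal{L})$, $D\in\mathcal{B}(\mathcal{L})$. Then: (i) $\dim\mathcal{K}=\dim\mathcal{L}$ and $\mathcal{R}(T_1)=\mathcal{R}(T_2)$. (ii) $T$ is a product of two idempotents: $T=E_1E_2$ with $$E_1=\begin{bmatrix}I_{\mathcal{K}}&T_1C^{-1}-C^{-1}(I_{\mathcal{L}}-D)\\ 0&0\end{bmatrix},\qquad E_2=\begin{bmatrix}I_{\mathcal{K}}-C^{-1}DC&C^{-1}(I_{\mathcal{L}}-D)D\\ C&D\end{bmatrix}.$$ (iii) If $\dim\mathcal{L}$ $(=\dim\mathcal{K})$ is $\ge2$, then (ii) can be done in uncountably many ways, i.e. $T$ can be written in uncountably many ways as a product of two idempotents $\begin{bmatrix}I_{\mathcal{K}}&T_1C^{-1}-C^{-1}(I_{\mathcal{L}}-D)\\ 0&0\end{bmatrix}$ and $\begin{bmatrix}I_{\mathcal{K}}-C^{-1}DC&C^{-1}(I_{\mathcal{L}}-D)D\\ C&D\end{bmatrix}$ (in this order), for various invertible $C\in\mathcal{B}(\mathcal{K},\mathcal{L})$, $D\in\mathcal{B}(\mathcal{L})$ with $T_1C^{-1}=T_2D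^{-1}$.
   Context: $X$ is a complex Banach space; $\mathcal{B}(X_1,X_2)$ denotes the bounded linear maps $X_1\to X_2$, $\mathcal{B}(X)=\mathcal{B}(X,X)$, and $\mathcal{R}(\cdot)$ denotes range. A non-zero left (right) annihilator of $T$ is a non-zero $A\in\mathcal{B}(X)$ with $AT=0$ ($TA=0$). ''$X=\mathcal{K}\oplus\mathcal{L}$, a topological sum'' means $\mathcal{K},\mathcal{L}$ are closed subspaces, both different from $\{0\}$ and $X$, with $\mathcal{K}\cap\mathcal{L}=\{0\}$, $\mathcal{K}+\mathcal{L}=X$ and bounded associated projections. Operators are written in block form $\begin{bmatrix}A_1&A_2\\ A_3&A_4\end{bmatrix}$ with $A(k+l)=(A_1k+A_2l)+(A_3k+A_4l)$ for $k\in\mathcal{K}$, $l\in\mathcal{L}$. A local block representation of $T$ is its block form $\begin{bmatrix}T_1&T_2\\ 0&0\end{bmatrix}$ with respect to a topological sum $X=\mathcal{K}\oplus\mathcal{L}$ such that $\mathcal{K}$ contains the closure of $\mathcal{R}(T)$. The dimension of a Banach space is the smallest cardinality of a subset with dense linear span. Invertible means bijective with bounded inverse. *)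

(* Defs.v *)
From HB Require Import structures.
From mathcomp Require Import all_boot all_order all_algebra complex.
From mathcomp Require Import all_classical all_reals all_analysis.

Set Implicit Arguments.
Unset Strict Implicit.
Unset Printing Implicit Defensive.

Import Order.TTheory GRing.Theory Num.Theory.
Import numFieldNormedType.Exports.

Local Open Scope classical_set_scope.
Local Open Scope ring_scope.

Section BoundedOperators.
Context {F : numFieldType}.

Record boundedOp (U V : normedModType F) := BoundedOp {
  bop_fun :> {linear U -> V};
  bop_bounded : bounded_near bop_fun (nbhs (0 : U)) }.

(* [C] is invertible (bijective with bounded inverse), with inverse [C']. *)
Definition is_inverse (U V : normedModType F)
    (C : boundedOp U V) (C' : boundedOp V U) : Prop :=
  cancel C C' /\ cancel C' C.

Definition has_left_annihilator (U : normedModType F) (T : boundedOp U U) :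
    Prop :=
  exists A : boundedOp U U, (A : U -> U) <> \0 /\ A \o T = \0.

Definition has_right_annihilator (U : normedModType F) (T : boundedOp U U) :
    Prop :=
  exists A : boundedOp U U, (A : U -> U) <> \0 /\ T \o A = \0.

Definition idempotent_op (U : normedModType F) (E : boundedOp U U) : Prop :=
  E \o E = E :> (U -> U).

End BoundedOperators.

Section Dimension.
Context {F : numFieldType}.

Definition linear_span (U : normedModType F) (A : set U) : set U :=
  [set x | exists n (a : 'I_n -> F) (v : 'I_n -> U),
    (forall i, A (v i)) /\ x = \sum_(i < n) a i *: v i].

(* The dimension is a possibly infinite cardinal; it is represented by the
   sets that attain the smallest cardinality, so that the cardinality of such
   a set is the dimension. *)
Definition attains_dim (U : normedModType F) (A : set U) : Prop :=
  dense (linear_span A) /\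
  forall B : set U, dense (linear_span B) -> (A #<= B)%card.

Definition same_dim (U V : normedModType F) : Prop :=
  exists (A : set U) (B : set V),
    [/\ attains_dim A, attains_dim B & (A #= B)%card].

Definition dim_ge (n : nat) (U : normedModType F) : Prop :=
  exists A : set U, attains_dim A /\ (`I_n #<= A)%card.

End Dimension.

Section ClosedSubspaces.
Context {F : numFieldType} {X : normedModType F}.

Record closedSubspace := ClosedSubspace {
  cs_set : set X;
  cs_0 : cs_set 0;
  cs_D : forall x y, cs_set x -> cs_set y -> cs_set (x + y);
  cs_Z : forall (a : F) x, cs_set x -> cs_set (a *: x);
  cs_closed : closed cs_set }.

Definition cs_mem (K : closedSubspace) : X -> bool := fun x => x \in cs_set K.

Lemma cs_mem_submod (K : closedSubspace) : subsemimod_closed (cs_mem K).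
Proof.
split; first split.
- by rewrite /cs_mem unfold_in; apply/asboolP/cs_0.
- by move=> x y; rewrite /cs_mem !unfold_in => /asboolP ? /asboolP ?;
    apply/asboolP/cs_D.
- by move=> a x; rewrite /cs_mem !unfold_in => /asboolP ?; apply/asboolP/cs_Z.
Qed.

HB.instance Definition _ (K : closedSubspace) :=
  GRing.isSubmodClosed.Build F X (cs_mem K) (cs_mem_submod K).

Record cs_type (K : closedSubspace) := CSType {
  cs_val :> X;
  cs_valP : cs_val \in cs_mem K }.

HB.instance Definition _ K := [isSub for @cs_val K].
HB.instance Definition _ K := [Choice of cs_type K by <:].
HB.instance Definition _ K := [SubChoice_isSubLmodule of cs_type K by <:].

Lemma cs_ler_normD K (x y : cs_type K) :
  `|cs_val (x + y)| <= `|cs_val x| + `|cs_val y|.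
Proof. exact: ler_normD. Qed.

Lemma cs_normrZ K (a : F) (x : cs_type K) :
  `|cs_val (a *: x)| = `|a| * `|cs_val x|.
Proof. exact: normrZ. Qed.

Lemma cs_normr0_eq0 K (x : cs_type K) : `|cs_val x| = 0 -> x = 0.
Proof. by move=> /normr0_eq0 x0; exact: val_inj. Qed.

HB.instance Definition _ K := Lmodule_isNormed.Build F (cs_type K)
  (@cs_ler_normD K) (@cs_normrZ K) (@cs_normr0_eq0 K).

End ClosedSubspaces.

Arguments closedSubspace {F} X.

Coercion cs_type : closedSubspace >-> Sortclass.

Section TopologicalSums.
Context {F : numFieldType} {X : normedModType F}.

Definition topological_sum (K L : closedSubspace X) : Prop :=
  [/\ [/\ cs_set K <> [set 0], cs_set K <> setT,
          cs_set L <> [set 0] & cs_set L <> setT],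
      cs_set K `&` cs_set L = [set 0],
      forall x : X, exists (k : K) (l : L), x = (k : X) + (l : X) &
      exists (P : boundedOp X K) (Q : boundedOp X L),
        forall (k : K) (l : L),
          P ((k : X) + (l : X)) = k /\ Q ((k : X) + (l : X)) = l].

(* The column on the left acts on [K], that on the right acts on [L]. *)
Definition block_form (K L : closedSubspace X) (A : boundedOp X X)
    (A1 : K -> K) (A2 : L -> K) (A3 : K -> L) (A4 : L -> L) : Prop :=
  forall (k : K) (l : L),
    A ((k : X) + (l : X)) = (A1 k + A2 l : X) + (A3 k + A4 l : X).

Definition local_block_representation (K L : closedSubspace X)
    (T : boundedOp X X) (T1 : boundedOp K K) (T2 : boundedOp L K) : Prop :=
  [/\ topological_sum K L, closure (range T) `<=` cs_set K
    & block_form T T1 T2 \0 \0].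

(* [C'] stands for the inverse of [C]. *)
Definition block_E1 (K L : closedSubspace X) (T1 : boundedOp K K)
    (C' : boundedOp L K) (D : boundedOp L L) (E1 : boundedOp X X) : Prop :=
  block_form E1
    idfun ((T1 \o C') \- (C' \o (idfun \- D)))
    \0    \0.

Definition block_E2 (K L : closedSubspace X) (C : boundedOp K L)
    (C' : boundedOp L K) (D : boundedOp L L) (E2 : boundedOp X X) : Prop :=
  block_form E2
    (idfun \- (C' \o D \o C)) (C' \o (idfun \- D) \o D)
    C                         D.

Definition two_idempotents (T E1 E2 : boundedOp X X) : Prop :=
  [/\ idempotent_op E1, idempotent_op E2 & E1 \o E2 = T :> (X -> X)].

End TopologicalSums.

(* Main.v *)
(* Put [S = T1 C^-1 = T2 D^-1], so that [T1 = S C] and [T2 = S D]; the algebra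
   of the factorization [T = E1 E2] then reduces to the identity
   [C k1 = u - D u] for [E2 (k + l) = k1 + u].  Equality of dimensions holds
   because the homeomorphism [C] transports sets with dense span.  The condition
   [T1 C^-1 = T2 D^-1] is preserved when [C] and [D] are both multiplied by the
   same scalar [a <> 0], and [a C] is a block of [E2], so the positive reals
   inject into the set of factorizations. *)

Require Import Defs.
From mathcomp Require Import all_boot all_order all_algebra complex.
From mathcomp Require Import all_classical all_reals all_analysis.
Set Implicit Arguments.
Unset Strict Implicit.
Unset Printing Implicit Defensive.

Import Order.TTheory GRing.Theory Num.Theory.
Import numFieldNormedType.Exports.
Local Open Scope classical_set_scope.
Local Open Scope ring_scope.

(** * Algebra of bounded operators *)

Section BoundedOperatorAlgebra.
Context {F : numFieldType}.

Lemma bop_continuous (U V : normedModType F) (f : boundedOp U V) :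
  continuous f.
Proof. exact/bounded_linear_continuous/bop_bounded. Qed.

(** For linear maps continuity at 0 gives boundedness, so the operations below inherit boundedness
    from the closure properties of continuity. *)
Definition continuous_op (U V : normedModType F) (f : {linear U -> V})
    (cf : continuous f) : boundedOp U V :=
  BoundedOp (continuous_linear_bounded 0 (cf 0)).

Definition bop_id (U : normedModType F) : boundedOp U U :=
  @continuous_op U U idfun (fun x => cvg_id).

Definition bop_comp (U V W : normedModType F)
    (g : boundedOp V W) (f : boundedOp U V) : boundedOp U W :=
  @continuous_op U W (g \o f) (fun x =>
    continuous_comp (@bop_continuous _ _ f x) (@bop_continuous _ _ g (f x))).

Definition bop_add (U V : normedModType F) (f g : boundedOp U V) :
    boundedOp U V :=
  @continuous_op U V (f \+ g) (fun x =>
    continuousD (@bop_continuous _ _ f x) (@bop_continuous _ _ g x)).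

Definition bop_sub (U V : normedModType F) (f g : boundedOp U V) :
    boundedOp U V :=
  @continuous_op U V (f \- g) (fun x =>
    continuousB (@bop_continuous _ _ f x) (@bop_continuous _ _ g x)).

Definition bop_zero (U V : normedModType F) : boundedOp U V :=
  @continuous_op U V \0 (fun x => @cvg_cst V 0 U (nbhs x) _).

Definition bop_scale (U V : normedModType F) (a : F) (f : boundedOp U V) :
    boundedOp U V :=
  @continuous_op U V (a \*: f) (fun x =>
    continuousZl_tmp (k := a) (@bop_continuous _ _ f x)).

Lemma cs_val_bounded (X : normedModType F) (K : closedSubspace X) :
  bounded_near (val : {linear K -> X}) (nbhs (0 : K)).
Proof.
by apply/linear_boundedP; exists 1; split=> // r r1 x; rewrite ler_peMl // ltW.
Qed.

Definition cs_incl (X : normedModType F) (K : closedSubspace X) :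
    boundedOp K X := BoundedOp (@cs_val_bounded _ K).

End BoundedOperatorAlgebra.

(** * Least cardinalities *)

Lemma set_inj_card_le (T U : Type) (A : set T) (B : set U) (f : T -> U) :
  set_fun A B f -> set_inj A f -> (A #<= B)%card.
Proof.
move=> fAB finj; have [g] : $|{injfun A >-> B}| by apply/injfunPex; exists f.
exact: (inj_card_le g).
Qed.

(* A maximal set [Y] of choice functions on [G] that is evaluated injectively at
   every [B] in [G] must be evaluated onto some [A] in [G], since otherwise the
   missed points would form one more choice function.  This [A] then embeds
   into every [B] through [Y]. *)
Lemma exists_card_le_min (T : Type) (G : set (set T)) : G !=set0 ->
  exists2 A, G A & forall B, G B -> (A #<= B)%card.
Proof.
move=> G0.
pose P (Y : set (set T -> T)) := forall B, G B ->
  (forall f, Y f -> B (f B)) /\ (forall f g, Y f -> Y g -> f B = g B -> f = g).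
have [|Y [PY Ymax]] := @Zorn_bigcup _ P.
  move=> Z ZP Ztot B GB; split.
    by move=> f [Y ZY Yf]; have [+ _] := ZP _ ZY B GB; apply.
  move=> f g [Y1 Z1 Y1f] [Y2 Z2 Y2g].
  have [Y12|Y21] := Ztot _ _ Z1 Z2.
    by have [_ +] := ZP _ Z2 B GB; apply => //; exact: Y12.
  by have [_ +] := ZP _ Z1 B GB; apply => //; exact: Y21.
have [A [GA sA]] : exists A, G A /\ forall a, A a -> exists2 f, Y f & f A = a.
  apply: contrapT => nA.
  have miss B : exists b, G B -> B b /\ forall f, Y f -> f B <> b.
    apply: contrapT => ne; apply: nA; have [GB|nGB] := pselect (G B).
      exists B; split=> // a Ba.
      apply: contrapT => nf; apply: ne; exists a => _; split=> // f Yf fa.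
      by apply: nf; exists f.
    (* Outside [G] any point would serve, so [ne] forces [T] to be empty, and [B0] is vacuously
       covered. *)
    have [B0 GB0] := G0; exists B0; split=> // a _.
    by exfalso; apply: ne; exists a => /nGB.
  have [h hP] := choice miss.
  apply: (Ymax (Y `|` [set h])).
    split; first by move=> f; left.
    have [B0 GB0] := G0; have [_ hB0] := hP _ GB0.
    by move=> /(_ h (or_intror erefl)) /hB0.
  move=> B GB; have [BhB hB] := hP B GB; have [YB injB] := PY B GB; split.
    by move=> f [/YB //|->].
  move=> f g [Yf|->] [Yg|->] //; first exact: injB.
  - by move=> /(hB _ Yf).
  - by move=> /esym /(hB _ Yg).
exists A => // B GB.
(* Off [A] the constant function is only a default value. *)
have /choice[k kP] : forall a, exists f : set T -> T, A a -> Y f /\ f A = a.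
  move=> a; have [Aa|nAa] := pselect (A a); last by exists (fun=> a).
  by have [f Yf fa] := sA a Aa; exists f.
have [kB injB] := PY B GB.
apply: (@set_inj_card_le _ _ _ _ (k^~ B)).
  by move=> a /kP[/kB].
move=> a b /set_mem/kP[Ya ka] /set_mem/kP[Yb kb] kab.
by rewrite -ka -kb (injB _ _ Ya Yb kab).
Qed.

(** * Invariance of dimension under isomorphism *)

Section DimensionInvariance.
Context {F : numFieldType}.

Lemma dense_linear_span_setT (U : normedModType F) :
  dense (linear_span [set: U]).
Proof.
move=> O [x Ox] _; exists x; split=> //.
by exists 1%N, (fun=> 1), (fun=> x); rewrite big_ord1 scale1r.
Qed.

(** The preimage of a nonempty open set under [f] is open by continuity and nonempty by
    surjectivity, so it meets the span of [A]. *)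
Lemma dense_linear_span_image (U V : normedModType F)
    (f : boundedOp U V) (g : boundedOp V U) (A : set U) :
  is_inverse f g -> dense (linear_span A) -> dense (linear_span (f @` A)).
Proof.
move=> [fK gK] dA O [y Oy] oO.
have /dA[|x [/= Ofx [n [a [v [Av xE]]]]]] : (f @^-1` O) !=set0.
- by exists (g y); rewrite /= gK.
- by apply: open_comp oO => x _; exact: bop_continuous.
exists (f x); split=> //; exists n, a, (f \o v); split=> [i /=|].
  by exists (v i).
by rewrite xE linear_sum; under eq_bigr do rewrite linearZ.
Qed.

Lemma is_inverse_same_dim (U V : normedModType F)
    (f : boundedOp U V) (g : boundedOp V U) : is_inverse f g -> same_dim U V.
Proof.
move=> fg; have [fK gK] := fg.
have [A dA Amin] := @exists_card_le_min U [set A | dense (linear_span A)]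
  (ex_intro _ setT (@dense_linear_span_setT U)).
have AfA : (f @` A #= A)%card.
  by apply: inj_card_eq => x y _ _; exact: (can_inj fK).
exists A, (f @` A); split; [by split | split | by rewrite card_eq_sym].
- exact: dense_linear_span_image fg dA.
- move=> B dB; have gf : is_inverse g f by split.
  have /Amin AB : dense (linear_span (g @` B)) by exact: dense_linear_span_image gf dB.
  have AfA' : (f @` A #<= A)%card by move: AfA; rewrite card_eq_le => /andP[].
  (* Minimality of [A] is tested against [B] pulled back by [g]. *)
  exact: card_le_trans AfA' (card_le_trans AB (card_image_le g B)).
Qed.

End DimensionInvariance.

(** * Block operators on a topological sum *)

Section Blocks.
Context {F : numFieldType} {X : normedModType F} {K L : closedSubspace X}.
Context (KL : topological_sum K L).

(** The bounded projections onto [K] and [L] turn the matrix into a bounded operator on [X]. *)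
Lemma exists_block_form (A1 : boundedOp K K) (A2 : boundedOp L K)
    (A3 : boundedOp K L) (A4 : boundedOp L L) :
  exists A : boundedOp X X, block_form A A1 A2 A3 A4.
Proof.
have [_ _ _ [P [Q PQ]]] := KL.
exists (bop_add
  (bop_comp (cs_incl K) (bop_add (bop_comp A1 P) (bop_comp A2 Q)))
  (bop_comp (cs_incl L) (bop_add (bop_comp A3 P) (bop_comp A4 Q)))).
by move=> k l /=; have [-> ->] := PQ k l.
Qed.

Lemma topological_sum_inj (k k' : K) (l l' : L) :
  cs_val k + cs_val l = cs_val k' + cs_val l' -> k = k' /\ l = l'.
Proof.
have [_ _ _ [P [Q PQ]]] := KL => e.
have [Pk Ql] := PQ k l; have [Pk' Ql'] := PQ k' l'.
by split; [rewrite -Pk e Pk'|rewrite -Ql e Ql'].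
Qed.

Lemma two_idempotents_block (T E1 E2 : boundedOp X X)
    (T1 : boundedOp K K) (T2 : boundedOp L K)
    (C : boundedOp K L) (C' : boundedOp L K) (D D' : boundedOp L L) :
  block_form T T1 T2 \0 \0 ->
  is_inverse C C' -> is_inverse D D' -> T1 \o C' = T2 \o D' ->
  block_E1 T1 C' D E1 -> block_E2 C C' D E2 -> two_idempotents T E1 E2.
Proof.
move=> bT [CK C'K] [DK D'K] eT bE1 bE2.
have [_ _ split_ _] := KL.
split; apply/funext => x; have [k [l ->]] := split_ x => /=;
  pose u := C k + D l; pose k1 := (k - C' (D (C k))) + C' (D l - D (D l));
  have E2kl : E2 (cs_val k + cs_val l) = cs_val k1 + cs_val u := bE2 k l;
  have Ck1 : C k1 = u - D u by
    rewrite linearD linearB !C'K linearD addrACA opprD.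
- by rewrite !bE1 /= !(addr0, linear0).
- rewrite E2kl.
  have -> : E2 (cs_val k1 + cs_val u) = cs_val (k1 - C' (D (C k1)) +
    C' (D u - D (D u))) + cs_val (C k1 + D u) := bE2 k1 u.
  (* By [Ck1] the lower entry is [u], and [D (C k1) = D u - D (D u)] makes the two correction terms
     of the upper entry cancel. *)
  by rewrite Ck1 linearB !subrK.
- have -> : T (cs_val k + cs_val l) =
    cs_val (T1 k + T2 l) + cs_val (0 + 0 : L) := bT k l.
  have E1k1u : E1 (cs_val k1 + cs_val u) =
    cs_val (k1 + (T1 (C' u) - C' (u - D u))) + cs_val (0 + 0 : L) := bE1 k1 u.
  (* Since [C' (u - D u) = k1], only [T1 (C' u)] survives; its part from [D l] is [T2 l] by [eT]. *)
  rewrite E2kl E1k1u -Ck1 CK [k1 + _]addrC subrK.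
  have /(congr1 (@^~ (D l))) /= := eT; rewrite DK => <-.
  by rewrite /u !linearD CK.
Qed.

End Blocks.

(** * Scaling and uncountability *)

Lemma scale_is_inverse (F : numFieldType) (U V : normedModType F)
    (f : boundedOp U V) (g : boundedOp V U) (a : F) :
  a != 0 -> is_inverse f g -> is_inverse (bop_scale a f) (bop_scale a^-1 g).
Proof.
move=> a0 [fK gK]; split=> x /=.
- by rewrite linearZ fK scalerA mulVf ?scale1r.
- by rewrite linearZ gK scalerA mulfV ?scale1r.
Qed.

(** Otherwise the interval from 0 to 1 would be countable, hence of Lebesgue measure 0 instead of
    1. *)
Lemma not_countable_inj_pos (R : realType) (T : Type) (S : set T) (f : R -> T) :
  (forall x, 0 < x -> S (f x)) ->
  (forall x y, 0 < x -> 0 < y -> f x = f y -> x = y) -> ~ countable S.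
Proof.
move=> fS finj cS.
have : countable (`]0, 1[%classic : set R).
  apply: sub_countable cS.
  apply: (@set_inj_card_le _ _ _ _ f).
    by move=> x /=; rewrite in_itv /= => /andP[x0 _]; exact: fS.
  move=> x y /set_mem /=; rewrite in_itv /= => /andP[x0 _].
  move=> /set_mem /=; rewrite in_itv /= => /andP[y0 _]; exact: finj.
move=> /countable_lebesgue_measure0 /eqP.
by rewrite lebesgue_measure_itv /= lte01 oppr0 adde0 onee_eq0.
Qed.

Theorem theorem4p13 (R : realType) (X : completeNormedModType R[i])
  (T : boundedOp X X) (K L : closedSubspace X)
  (T1 : boundedOp K K) (T2 : boundedOp L K)
  (C : boundedOp K L) (C' : boundedOp L K)
  (D : boundedOp L L) (D' : boundedOp L L)
  (T_neq0 : (T : X -> X) <> \0)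
  (T_neq1 : (T : X -> X) <> idfun)
  (T_left : has_left_annihilator T)
  (T_right : has_right_annihilator T)
  (T_block : local_block_representation T T1 T2)
  (T1_neq1 : (T1 : K -> K) <> idfun)
  (C_inv : is_inverse C C')
  (D_inv : is_inverse D D')
  (T1T2 : T1 \o C' = T2 \o D') :
  [/\ same_dim K L /\ range (fun k => T1 k) = range (fun l => T2 l),
      exists E1 E2 : boundedOp X X,
        [/\ block_E1 T1 C' D E1, block_E2 C C' D E2 & two_idempotents T E1 E2]
    & dim_ge 2 L ->
      ~ countable [set E : boundedOp X X * boundedOp X X |
          exists (C0 : boundedOp K L) (C0' : boundedOp L K)
                 (D0 D0' : boundedOp L L),
            [/\ is_inverse C0 C0', is_inverse D0 D0', T1 \o C0' = T2 \o D0',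
                block_E1 T1 C0' D0 E.1 /\ block_E2 C0 C0' D0 E.2
              & two_idempotents T E.1 E.2]]].
Proof.
have [KL _ bT] := T_block; have [CK C'K] := C_inv; have [DK D'K] := D_inv.
(* Stated for arbitrary [C0] and [D0], to serve both (ii) and the scaled pairs of (iii). *)
have existsE (C0 : boundedOp K L) (C0' : boundedOp L K) (D0 D0' : boundedOp L L) :
    is_inverse C0 C0' -> is_inverse D0 D0' -> T1 \o C0' = T2 \o D0' ->
    exists E1 E2 : boundedOp X X, [/\ block_E1 T1 C0' D0 E1,
      block_E2 C0 C0' D0 E2 & two_idempotents T E1 E2].
  move=> C0_inv D0_inv T1T20.
  have [E1 bE1] := exists_block_form KL (bop_id K)
    (bop_sub (bop_comp T1 C0') (bop_comp C0' (bop_sub (bop_id L) D0)))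
    (bop_zero K L) (bop_zero L L).
  have [E2 bE2] := exists_block_form KL
    (bop_sub (bop_id K) (bop_comp (bop_comp C0' D0) C0))
    (bop_comp (bop_comp C0' (bop_sub (bop_id L) D0)) D0) C0 D0.
  exists E1, E2; split=> //.
  exact: (two_idempotents_block KL bT C0_inv D0_inv T1T20 bE1 bE2).
split; last move=> _.
- split; first exact: is_inverse_same_dim C_inv.
  have T1C' l : T1 (C' l) = T2 (D' l) := congr1 (@^~ l) T1T2.
  apply/seteqP; split=> _ [z _ <-].
  + by exists (D' (C z)) => //; rewrite -T1C' CK.
  + by exists (C' (D z)) => //; rewrite T1C' DK.
- exact: existsE C_inv D_inv T1T2.
(* [L] is nonzero and [C] is onto; the vector [C k] will tell different scalars apart. *)
- have [k Ck0] : exists k, C k != 0.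
    apply: contrapT => nk; have [[_ _ + _] _ _ _] := KL; apply.
    apply/seteqP; split=> [y Ly|_ ->]; last exact: cs_0.
    have Ly' : y \in cs_mem L by rewrite unfold_in; exact: mem_set.
    apply: contrapT => y0; apply: nk; exists (C' (CSType Ly')); rewrite C'K.
    by apply/eqP => /(congr1 (@cs_val _ _ _)).
  have T1T2_scale a : T1 \o bop_scale a C' = T2 \o bop_scale a D'.
    apply/funext => l /=; rewrite !linearZ.
    by have /(congr1 (@^~ l)) /= -> := T1T2.
  have /choice[E EP] x : exists E : boundedOp X X * boundedOp X X, 0 < x ->
      let a := real_complex R x in
      [/\ block_E1 T1 (bop_scale a^-1 C') (bop_scale a D) E.1,
          block_E2 (bop_scale a C) (bop_scale a^-1 C') (bop_scale a D) E.2
        & two_idempotents T E.1 E.2].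
    (* The identity pair is a default value for [x <= 0]. *)
    have [x0|_] := ltP 0 x; last by exists (bop_id X, bop_id X).
    have a0 : real_complex R x != 0 by rewrite fmorph_eq0 gt_eqF.
    have [E1 [E2 [bE1 bE2 T12]]] := existsE _ _ _ _
      (scale_is_inverse a0 C_inv) (scale_is_inverse a0 D_inv) (T1T2_scale _).
    by exists (E1, E2).
  apply: (@not_countable_inj_pos R _ _ E) => [x x0|x y x0 y0 Exy].
  + have a0 : real_complex R x != 0 by rewrite fmorph_eq0 gt_eqF.
    have [bE1 bE2 T12] := EP x x0.
    exists (bop_scale (real_complex R x) C), (bop_scale (real_complex R x)^-1 C').
    exists (bop_scale (real_complex R x) D), (bop_scale (real_complex R x)^-1 D').
    by split=> //; exact: scale_is_inverse.
  + have [_ bx _] := EP x x0; have [_ + _] := EP y y0.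
    (* Comparing the [L]-components of the common second factor at [k] gives [x C k = y C k]. *)
    rewrite -Exy => /(_ k 0); rewrite bx => /(topological_sum_inj KL)[_ /=].
    rewrite !linear0 !addr0 => /eqP.
    rewrite -subr_eq0 -scalerBl scaler_eq0 (negPf Ck0) orbF subr_eq0.
    by move=> /eqP/complexI.
Qed.
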